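(* Let $\dot S_n$ be the subgroup of $B_n$ generated by $s_1,\dots,s_{n-1}$, and let $\pi\in\dot S_n$ have generalized standard $OGS$ presentation $\pi=\tau_{k_1}^{i_{k_1}}\cdot\tau_{k_2}^{i_{k_2}}\cdots\tau_{k_m}^{i_{k_m}}$ (so that $\sum_{j=1}^m i_{k_j}=0$ and $-k_r\le\sum_{j=1}^r i_{k_j}\le 0$ for $r<m$). Then for every $1\le j\le m$, $$s_{k_j}\in des(\pi)\iff i_{k_j}<0 .$$
   Context: $B_n$ is the group of signed permutations, i.e. the bijections $\pi$ of $\{\pm1,\dots,\pm n\}$ with $\pi(-i)=-\pi(i)$. It is a Coxeter group with generators $s_0,\dots,s_{n-1}$, where $s_0$ exchanges $1$ and $-1$, and for $1\le i\le n-1$, $s_i$ exchanges $i$ with $i+1$ and $-i$ with $-(i+1)$. Products are read from left to right: $(\pi_1\cdot\pi_2)(i)=\pi_2(\pi_1(i))$. For $1\le k\le n$, $\tau_k=s_0s_1\cdots s_{k-1}$. Every element of $B_n$ has a unique presentation $\tau_1^{i_1}\cdots\tau_n^{i_n}$ with integers $-k\le i_k<k$, called its generalized standard $OGS$ presentation; omitting trivial factors it is written $\tau_{k_1}^{i_{k_1}}\cdots\tau_{k_m}^{i_{k_m}}$ with $k_1<\dots<k_m$ and nonzero exponents. The descent set is $des(\pi)=\{0\le i\le n-1 : \pi(i)>\pi(i+1)\}$ with $\pi(0):=0$; equivalently $i\in des(\pi)$ iff $\ell(s_i\cdot\pi)<\ell(\pi)$, where $\ell$ is the Coxeter length. ''$s_i\in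 des(\pi)$'' means $i\in des(\pi)$ (in particular it is false for $i=n$). *)

(* Defs.v *)
From mathcomp Require Import all_boot all_order all_algebra all_fingroup.

Set Implicit Arguments.
Unset Strict Implicit.
Unset Printing Implicit Defensive.

Import Order.TTheory GRing.Theory Num.Theory GroupScope.
Local Open Scope group_scope.

(* The set {+-1, ..., +-n}: the pair (b, a) stands for (-1)^b (a + 1),
   so b = true is the negative sign. *)
Notation pm n := (bool * 'I_n)%type.

Definition pmval n (x : pm n) : int := ((-1) ^+ x.1 * (x.2.+1)%:Z)%R.

Definition pmopp n (x : pm n) : pm n := (~~ x.1, x.2).

Lemma pmval_opp n (x : pm n) : pmval (pmopp x) = (- pmval x)%R.
Proof.
by rewrite /pmval; case: x => [[] a] /=;
   rewrite ?expr0 ?expr1 ?mul1r ?mulN1r ?opprK.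
Qed.

Lemma pmval_inj n : injective (@pmval n).
Proof.
by case=> [[] a] [[] b]; rewrite /pmval /= ?expr0 ?expr1 ?mul1r ?mulN1r //;
   [move/oppr_inj|]; case=> e; congr pair; apply: val_inj.
Qed.

(* The product of {perm _} is read from left to right:
   (p * q) x = q (p x) (lemma permM). *)
Definition Bn_set (n : nat) : {set {perm pm n}} :=
  [set p : {perm pm n} | [forall x, p (pmopp x) == pmopp (p x)]].

Lemma Bn_group_set n : group_set (Bn_set n).
Proof.
apply/group_setP; split=> [|p q].
  by rewrite inE; apply/forallP=> x; rewrite !perm1.
rewrite !inE => /forallP hp /forallP hq; apply/forallP=> x.
by rewrite !permM (eqP (hp x)) (eqP (hq _)).
Qed.

Definition Bn (n : nat) : {group {perm pm n}} := group (@Bn_group_set n).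

(* For a > 0 the ordinals ord_pred a and a carry the values a and a + 1 of
   {1, ..., n}; hence sgen a exchanges a with a + 1 and -a with -(a + 1).  (ord_pred is
   cyclic, but it is only used here for a > 0.) *)
Definition sgen n (a : 'I_n) : {perm pm n} :=
  if (a : nat) == 0%N then tperm (false, a) (true, a)
  else tperm (false, ord_pred a) (false, a) * tperm (true, ord_pred a) (true, a).

(* tau n k = s_0 s_1 ... s_(k-1), for k <= n. *)
Definition tau (n k : nat) : {perm pm n} := \prod_(a < n | (a < k)%N) sgen a.

Definition Sdot (n : nat) : {group {perm pm n}} :=
  [group of <<[set sgen a | a : 'I_n & (0 < a)%N]>>].

Lemma sgen_in_Bn n (a : 'I_n) : sgen a \in Bn n.
Proof.
have tE (u v x : pm n) :
    tperm u v x = if x == u then v else if x == v then u else x.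
  by case: tpermP => [->|->|/eqP/negbTE-> /eqP/negbTE->]; rewrite ?eqxx //; case: eqP.
rewrite inE; apply/forallP=> -[b c]; apply/eqP; rewrite /sgen.
case: ifP => _; rewrite ?permM !tE /pmopp !xpair_eqE /=.
  by case: b => /=; case: (c == a).
by case: b => /=; case cp: (c == ord_pred a) => /=; case ca: (c == a);
   rewrite /= ?xpair_eqE ?cp ?ca.
Qed.

Lemma Sdot_sub_Bn n : Sdot n \subset Bn n.
Proof. by rewrite gen_subG; apply/subsetP=> p /imsetP[a _ ->]; apply: sgen_in_Bn. Qed.

Definition zexpg (gT : finGroupType) (x : gT) (z : int) : gT :=
  match z with Posz e => x ^+ e | Negz e => x ^- e.+1 end.

(* image_at p a is p(a) for 1 <= a <= n, with the convention p(0) = 0. *)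
Definition image_at n (p : {perm pm n}) (a : nat) : int :=
  if a is b.+1 then oapp (fun c : 'I_n => pmval (p (false, c))) 0%R (insub b)
  else 0%R.

Definition des n (p : {perm pm n}) : pred nat :=
  [pred a | (a < n)%N && (image_at p a.+1 < image_at p a)%R].

(* The exponent of tau_k is i k; only the values i (k j), j < m, matter. *)
Definition OGS_presentation n (p : {perm pm n}) (m : nat)
    (k : 'I_m -> nat) (i : nat -> int) : Prop :=
  [/\ forall j, (1 <= k j <= n)%N,
      forall j1 j2 : 'I_m, (j1 < j2)%N -> (k j1 < k j2)%N,
      forall j, i (k j) != 0%R,
      forall j, (- (k j)%:Z <= i (k j) < (k j)%:Z)%R
    & p = \prod_(j < m) zexpg (tau n (k j)) (i (k j))].

(* Main.v *)
Require Import Defs.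
From mathcomp Require Import all_boot all_order all_algebra all_fingroup.
From mathcomp Require Import zify.

Set Implicit Arguments.
Unset Strict Implicit.
Unset Printing Implicit Defensive.

Import Order.TTheory GRing.Theory Num.Theory GroupScope.

(** On the circle 1, 2, ..., k, -1, -2, ..., -k (in this cyclic order) tau_k is the
    rotation by one step backwards, so it preserves the orientation of pairs:
    "the shorter arc between x and y runs forward from x to y".  The circle of
    size 2k embeds in that of size 2k' for k < k' without changing orientations.
    Now k_j and k_j + 1 are fixed by the factors before tau_{k_j}, and
    tau_{k_j}^i fixes k_j + 1 and sends k_j to some u with |u| <= k_j that is
    negative iff i < 0; thus the pair (u, k_j + 1) is oriented forward iff i > 0.
    The later factors preserve this orientation, and as pi preserves signs the
    final pair is positive, where forward orientation just means <. *)

(** Changing one sign moves that point to its antipode and so reverses the orientation. No k occurs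
    in the formula, so one test serves the circles of all sizes. *)
Definition forward n (x y : pm n) : bool := x.1 (+) y.1 (+) (x.2 < y.2)%N.

Lemma tpermE (T : finType) (u v x : T) :
  tperm u v x = if x == u then v else if x == v then u else x.
Proof.
by case: tpermP => [->|->|/eqP/negbTE-> /eqP/negbTE->]; rewrite ?eqxx //; case: eqP.
Qed.

Lemma pm_eqP n (x y : pm n) : x.1 = y.1 -> (x.2 = y.2 :> nat) -> x = y.
Proof. by case: x y => [b c] [b' c'] /= -> /val_inj->. Qed.

Lemma sgen0E n (a : 'I_n) (x : pm n) : a = 0%N :> nat ->
  sgen a x = (if x.2 == a then ~~ x.1 else x.1, x.2).
Proof.
move=> a0; rewrite /sgen a0 eqxx tpermE; case: x => b c; rewrite !xpair_eqE /=.
by case: b; case: (c =P a) => [->|_].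
Qed.

Lemma sgenSE n (a : 'I_n) (x : pm n) : (0 < a)%N ->
  sgen a x = (x.1, if x.2 == ord_pred a then a
                   else if x.2 == a then ord_pred a else x.2).
Proof.
move=> a0; rewrite /sgen eqn0Ngt a0 /= permM !tpermE.
by case: x => -[] c; rewrite !xpair_eqE /=; case cp: (c == ord_pred a);
   case ca: (c == a); rewrite /= ?xpair_eqE ?cp ?ca ?(eqP cp) ?(eqP ca).
Qed.

Lemma ord_pred_gt0 n (a : 'I_n) : (0 < a)%N -> ord_pred a = a.-1 :> nat.
Proof. by case: a => a an /= a0; rewrite -subn1 -addnBAC // modnDr modn_small; lia. Qed.

(** Induction on k: for k > 0 the new factor s_k acts after tau_k. It carries the image of 1 or -1
    on from absolute value k to k + 1, and lowers to k the value k + 1 that tau_k fixed. *)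
Lemma tau_spec n k (x : pm n) : (k <= n)%N ->
  (tau n k x).1 = ((0 < k)%N && (x.2 == 0%N :> nat)) (+) x.1
  /\ (tau n k x).2 = (if (k <= x.2)%N then x.2 : nat
                      else if x.2 == 0%N :> nat then k.-1 else x.2.-1) :> nat.
Proof.
elim: k => [|k IH] kn; first by rewrite /tau big_pred0 // perm1.
have kn' := ltnW kn.
have -> : tau n k.+1 = tau n k * sgen (Ordinal kn).
  rewrite /tau !big_ord_narrow big_ord_recr /=.
  by congr (_ * sgen _); [apply: eq_bigr => a _; congr sgen|]; apply: val_inj.
rewrite permM; have [] := IH kn'; move: (tau n k x) => [b c] /= bE cE.
case: (posnP k) => [k0|kpos].
  rewrite sgen0E //= -val_eqE /= cE bE k0 /=.
  by case: (nat_of_ord x.2) => [|?] //=; case: (x.1).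
rewrite sgenSE //=; split; first by rewrite bE kpos.
have pE := ord_pred_gt0 (a := Ordinal kn) kpos.
rewrite -!val_eqE /= in pE *; rewrite pE cE.
rewrite !(fun_if val) /= pE cE.
by case: (ltngtP k x.2) => ? /=; case: (x.2 =P 0%N :> nat) => ? /=;
   do ![case: eqP => /= ?]; lia.
Qed.

Lemma tau_fix n k (x : pm n) : (0 < k <= n)%N -> (k <= x.2)%N -> tau n k x = x.
Proof.
case/andP=> k0 kn kx; have [e1 e2] := tau_spec x kn.
by apply: pm_eqP; rewrite ?e1 ?e2 ?kx //; case: eqP => [|_]; [lia|rewrite andbF].
Qed.

Definition compatible n k (x y x' y' : pm n) : Prop :=
  [/\ (x'.2 < k)%N, (y'.2 < k)%N, x'.2 != y'.2 & forward x' y' = forward x y].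

(** A point of absolute value 1 becomes the largest, which reverses the comparison, and it also
    changes sign; the two reversals cancel. *)
Lemma tau_compatible n k (x y : pm n) : (k <= n)%N ->
  (x.2 < k)%N -> (y.2 < k)%N -> x.2 != y.2 ->
  compatible k x y (tau n k x) (tau n k y).
Proof.
move=> kn xk yk; rewrite -val_eqE /= => xy.
have k0 : (0 < k)%N by lia.
have [x1 x2] := tau_spec x kn; have [y1 y2] := tau_spec y kn.
rewrite /compatible /forward -val_eqE /= x1 x2 y1 y2 k0 (ltn_geF xk) (ltn_geF yk) /=.
by case: (x.2 =P 0%N :> nat) => ? /=; case: (y.2 =P 0%N :> nat) => ? /=;
   split; try lia; case: (x.1); case: (y.1) => /=; lia.
Qed.

(** Finite order turns negative powers into natural ones, so induction on a natural exponent
    suffices for invariants. *)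
Lemma zexpg_nat (gT : finGroupType) (x : gT) z : exists e, zexpg x z = x ^+ e.
Proof.
by apply/cycleP; case: z => e /=; rewrite ?groupV mem_cycle.
Qed.

Lemma zexpg_tau_fix n k z (x : pm n) :
  (0 < k <= n)%N -> (k <= x.2)%N -> zexpg (tau n k) z x = x.
Proof.
move=> kn kx; have [e ->] := zexpg_nat (tau n k) z.
by elim: e => [|e IH]; rewrite ?perm1 // expgSr permM IH tau_fix.
Qed.

Lemma zexpg_tau_compatible n k z (x y : pm n) : (k <= n)%N ->
  (x.2 < k)%N -> (y.2 < k)%N -> x.2 != y.2 ->
  compatible k x y (zexpg (tau n k) z x) (zexpg (tau n k) z y).
Proof.
move=> kn xk yk xy; have [e ->] := zexpg_nat (tau n k) z.
elim: e => [|e [IHx IHy IHxy IHf]]; first by rewrite expg0 !perm1.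
rewrite expgSr !permM /compatible -IHf.
exact: tau_compatible.
Qed.

Lemma tau_expE n k e (x : pm n) : (k <= n)%N -> (e <= x.2 < k)%N ->
  ((tau n k ^+ e) x).1 = x.1 /\ ((tau n k ^+ e) x).2 = (x.2 - e)%N :> nat.
Proof.
move=> kn; elim: e => [|e IH] ex; first by rewrite expg0 perm1 subn0.
rewrite expgSr permM; have [|e1 e2] := IH; first lia.
have [-> ->] := tau_spec ((tau n k ^+ e) x) kn.
have -> : ((tau n k ^+ e) x).2 == 0%N :> nat = false by rewrite e2; lia.
by rewrite andbF e1 e2 ifN; [split|]; lia.
Qed.

Lemma zexpg_tau_top n k z (x : pm n) : (k <= n)%N ->
  (- k%:Z <= z < k%:Z)%R -> x.1 = false -> x.2.+1 = k ->
  (zexpg (tau n k) z x).1 = (z < 0)%R /\ ((zexpg (tau n k) z x).2 < k)%N.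
Proof.
move=> kn zk x1 x2; case: z zk => e zk /=.
  have [|-> ->] := @tau_expE n k e x kn; first lia.
  by split; [rewrite x1|]; lia.
have ek : (e < n)%N by lia.
(* Here z = -(e + 1), and rotating forward from k passes -1, ..., -(e + 1). The check rotates back:
   e steps to -1, one more to k. *)
suff -> : (tau n k ^- e.+1) x = (true, Ordinal ek) by split => //=; lia.
apply: (canLR (permK _)).
rewrite expgSr permM.
have [|e1 e2] := @tau_expE n k e (true, Ordinal ek) kn; first by simpl; lia.
have [t1 t2] := tau_spec ((tau n k ^+ e) (true, Ordinal ek)) kn.
rewrite e1 e2 /= subnn eqxx /= in t1 t2.
by apply: pm_eqP; rewrite ?t1 ?t2 ?x1 ?ifN; lia.
Qed.

Lemma prod_tau_fix n (i : nat -> int) s (x : pm n) :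
  all (fun t => 0 < t <= n)%N s -> all (fun t => t <= x.2)%N s ->
  (\prod_(t <- s) zexpg (tau n t) (i t)) x = x.
Proof.
elim: s => [|t s IH] /=; first by rewrite big_nil perm1.
case/andP=> tn sn /andP[tx sx].
by rewrite big_cons permM zexpg_tau_fix ?IH.
Qed.

(** As [x.2] is the absolute value minus one, c + 1 is still allowed; since c < t, both points lie
    on the circle of the next tau_t, and then t replaces c. *)
Lemma prod_tau_forward n (i : nat -> int) s (x y : pm n) c :
  all (fun t => 0 < t <= n)%N s -> path ltn c s ->
  (x.2 <= c)%N -> (y.2 <= c)%N -> x.2 != y.2 ->
  let p := \prod_(t <- s) zexpg (tau n t) (i t) in
  (p x).2 != (p y).2 /\ forward (p x) (p y) = forward x y.
Proof.
elim: s x y c => [|t s IH] x y c /=; first by rewrite big_nil !perm1.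
case/andP=> tn sn /andP[ct cs] xc yc xy; rewrite big_cons !permM.
have [||||a b d <-] // := @zexpg_tau_compatible n t (i t) x y; try lia.
by apply: (IH _ _ t); rewrite ?(ltnW a) ?(ltnW b).
Qed.

(** The generators keep signs, hence lie in the stabiliser of the set of negative points, which is a
    group. *)
Lemma Sdot_sign n (p : {perm pm n}) x : p \in Sdot n -> (p x).1 = x.1.
Proof.
have sub : Sdot n \subset 'N([set y : pm n | y.1] | 'P).
  rewrite gen_subG; apply/subsetP=> _ /imsetP[a /[!inE] a0 ->].
  apply/subsetP=> y; rewrite !inE /= /aperm sgenSE //.
by move/(subsetP sub)/(astabs_act x); rewrite !inE /= apermE.
Qed.

Lemma image_atE n (p : {perm pm n}) (c : 'I_n) :
  image_at p c.+1 = pmval (p (false, c)).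
Proof. by rewrite /image_at /= insubT //= => cn; congr (pmval (p (_, _))); apply: val_inj. Qed.

Lemma desE n (p : {perm pm n}) a :
  (a \in des p) = (a < n)%N && (image_at p a.+1 < image_at p a)%R.
Proof. by []. Qed.

Lemma pmval_lt_pos n (x y : pm n) : ~~ x.1 -> ~~ y.1 ->
  (pmval x < pmval y)%R = (x.2 < y.2)%N.
Proof.
by rewrite /pmval; case: x y => [[] a] [[] b] //= _ _; rewrite expr0 !mul1r ltz_nat.
Qed.

Theorem proposition6p0p1 (n : nat) (pi : {perm pm n}) (pi_in : pi \in Sdot n)
    (m : nat) (k : 'I_m -> nat) (i : nat -> int)
    (pi_OGS : OGS_presentation pi k i) (j : 'I_m) :
  k j \in des pi <-> (i (k j) < 0)%R.
Proof.
case: pi_OGS => k_range k_incr _ i_range piE.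
pose s := [seq k l | l <- enum 'I_m].
have {}piE : pi = \prod_(t <- s) zexpg (tau n t) (i t).
  by rewrite piE [RHS]big_map enumT [index_enum _]unlock.
have s_range : all (fun t => 0 < t <= n)%N s.
  by apply/allP=> _ /mapP[l _ ->].
have s_sorted : sorted ltn s.
  apply: (homo_sorted k_incr).
  by rewrite -(@sorted_map _ _ val ltn) val_enum_ord iota_ltn_sorted.
have ks : k j \in s by rewrite map_f ?mem_enum.
have ir := i_range j; have /andP[k0 kn] := k_range j.
clearbody s; move: (k j) ks ir k0 kn => t ts ir t0 tn {k k_range k_incr i_range j}.
case/splitPr: ts piE s_range s_sorted => s1 s2 piE.
rewrite all_cat /= => /and3P[s1n _ s2n] s_sorted.
have ts2 : path ltn t s2.
  by move: s_sorted => /cat_sorted2[].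
have s1t : all (fun t' => t' < t)%N s1.
  move: s_sorted; rewrite (sorted_pairwise ltn_trans) pairwise_cat.
  by case/andP=> /allrelP h _; apply/allP => a /h; apply; rewrite mem_head.
have t1n : (t.-1 < n)%N by lia.
(* Ordinals count from zero: [x] is the point k_j, and [v] below is k_j + 1. *)
pose x : pm n := (false, Ordinal t1n).
pose y := zexpg (tau n t) (i t) x.
have [y1 y2] : y.1 = (i t < 0)%R /\ (y.2 < t)%N.
  by apply: zexpg_tau_top => //=; lia.
pose r := \prod_(t' <- s2) zexpg (tau n t') (i t').
have pix : pi x = r y.
  rewrite piE big_cat big_cons /= !permM (prod_tau_fix i s1n) //.
  by apply: sub_all s1t => a /=; lia.
have pi_sign z := Sdot_sign z pi_in.
rewrite desE; case: (ltnP t n) => [lt_tn|le_nt]; last first.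
  (* For t = n no later factor remains, so [y] is the image of [x] under [pi], which is positive:
     both sides are false. *)
  have s20 : s2 = [::].
    case: (s2) s2n ts2 => //= a ? /andP[? _] /andP[? _]; lia.
  by move: (pi_sign x); rewrite pix /r s20 big_nil perm1 y1 /= => ->.
pose v : pm n := (false, Ordinal lt_tn).
have piv : pi v = r v.
  rewrite piE big_cat big_cons /= !permM (prod_tau_fix i s1n) //.
    by rewrite zexpg_tau_fix //= t0.
  by apply: sub_all s1t => a /=; lia.
have yv : y.2 != v.2 by rewrite -val_eqE /= neq_ltn y2.
have [ne fw] := @prod_tau_forward n i s2 y v t s2n ts2 (ltnW y2) (leqnn t) yv.
rewrite -/r -pix -piv -val_eqE /= in ne.
(* Both images are positive, so [fw] now says that they increase exactly when i t is not negative;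
   [ne] rules out equality. *)
rewrite -/r -pix -piv /forward !pi_sign /= y1 y2 in fw.
have -> : image_at pi t = pmval (pi x).
  by rewrite -(image_atE pi (Ordinal t1n)); congr image_at; rewrite /= prednK.
rewrite (image_atE pi (Ordinal lt_tn)) -/v pmval_lt_pos ?pi_sign //; lia.
Qed.
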